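(* For $n\ge 0$ and $0\le j\le i$, let $A_{i,j}(n)$ be the number of $3$-nonnesting open partition diagrams of size $n$ having exactly $i$ semi-arcs, exactly $j$ of which belong to some future $2$-nesting. Then the number of $3$-nonnesting set partitions of $\{1,\dots,n\}$ is \[ A_{0,0}(n)=\sum_{\substack{a,b,c\ge 0\\ a+b+c=n}}\binom{n}{a,b,c}^2\left(1-\frac{c}{b+1}\right) +\sum_{k=0}^{n-1}\ \sum_{0\le j\le i\le k}A_{i,j}(k)\left(\sum_{p,q,r}\binom{n-k}{p,q,r}\binom{n-k-1}{p-i,\,q+i,\,r-1}\left(\frac{r-1}{q+i+1}-1\right)\right), \] where the innermost sum runs over integers $p,q,r\ge 0$ with $p+q+r=n-k$, and a multinomial coefficient with a negative lower entry is $0$.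
   Context: An open partition diagram of size $n\ge 0$ consists of vertices $1,\dots,n$ in a row, a set of arcs $(a,b)$ with $1\le a<b\le n$ and a set of semi-arcs $(a,* )$ with $1\le a\le n$ (a semi-arc has a left end-point but no right end-point), such that every vertex is the left end-point of at most one arc or semi-arc and the right end-point of at most one arc. (Equivalently: a set partition of $\{1,\dots,n\}$ with each block marked closed or open; block $\{a_1<\dots<a_r\}$ gives arcs $(a_1,a_2),\dots,(a_{r-1},a_r)$ and, if open, the semi-arc $(a_r,* )$.) Set partitions are identified with the diagrams having no semi-arcs. A $k$-nesting is a set of $k$ arcs $(i_1,j_1),\dots,(i_k,j_k)$ with $i_1<\dots<i_k<j_k<\dots<j_1$. A future $k$-nesting is a $(k-1)$-nesting $(i_2,j_2),\dots,(i_k,j_k)$ together with a semi-arc $(i_1,* )$ with $i_1<i_2$. An open partition diagram is $k$-nonnesting if it contains neither a $k$-nesting nor a future $k$-nesting. The multinomial coefficient $\binom{N}{x,y,w}$ equals $N!/(x!y!w!)$ when $x,y,w\ge0$ and $x+y+w=N$. *)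

(* Defs.v *)
From mathcomp Require Import all_boot all_order all_algebra.
Set Implicit Arguments.
Unset Strict Implicit.
Unset Printing Implicit Defensive.
Import Order.TTheory GRing.Theory Num.Theory.

(* The vertices 1, ..., n are represented by 'I_n = {0, ..., n-1}.  A diagram
   D is the pair (set of arcs, set of left end-points of semi-arcs). *)
Definition diagram (n : nat) : Type :=
  ({set 'I_n * 'I_n} * {set 'I_n})%type.

Definition arcs n (D : diagram n) : {set 'I_n * 'I_n} := D.1.
Definition semiarcs n (D : diagram n) : {set 'I_n} := D.2.

Definition open_partition_diagram n (D : diagram n) : bool :=
  [&& [forall e in arcs D, e.1 < e.2],
      [forall x : 'I_n,
         #|[set e in arcs D | e.1 == x]| + (x \in semiarcs D) <= 1]
    & [forall y : 'I_n, #|[set e in arcs D | e.2 == y]| <= 1]].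

(* [:: i_1; ...; i_k; j_k; ...; j_1] for s = [:: (i_1, j_1); ...; (i_k, j_k)] *)
Definition endpoints n (s : seq ('I_n * 'I_n)) : seq nat :=
  [seq val e.1 | e <- s] ++ rev [seq val e.2 | e <- s].

Definition is_nesting n (D : diagram n) (s : seq ('I_n * 'I_n)) : bool :=
  all (fun e => e \in arcs D) s && sorted ltn (endpoints s).

Definition has_nesting (k n : nat) (D : diagram n) : bool :=
  [exists t : k.-tuple ('I_n * 'I_n), is_nesting D t].

(* The semi-arc (x, * ) belongs to a future k-nesting (k >= 2).  The sequence
   x :: endpoints t being increasing is i_1 < i_2 together with the nesting
   condition on the k - 1 arcs t. *)
Definition in_future_nesting (k n : nat) (D : diagram n) (x : 'I_n) : bool :=
  (x \in semiarcs D) &&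
  [exists t : k.-1.-tuple ('I_n * 'I_n),
     is_nesting D t && sorted ltn (val x :: endpoints t)].

Definition nonnesting (k n : nat) (D : diagram n) : bool :=
  ~~ has_nesting k D && ~~ [exists x : 'I_n, in_future_nesting k D x].

Definition A (i j n : nat) : nat :=
  #|[set D : diagram n |
      [&& open_partition_diagram D, nonnesting 3 D, #|semiarcs D| == i
        & #|[set x | in_future_nesting 2 D x]| == j]]|.

(* The diagram of a set partition: arcs join consecutive elements of a block,
   and there are no semi-arcs. *)
Definition partition_diagram n (P : {set {set 'I_n}}) : diagram n :=
  ([set e : 'I_n * 'I_n |
     [exists B in P, [&& e.1 \in B, e.2 \in B, e.1 < e.2
        & [forall z in B, ~~ (e.1 < z < e.2)]]]], set0).

Definition nonnesting_partitions (k n : nat) : {set {set {set 'I_n}}} :=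
  [set P | partition P [set: 'I_n] & nonnesting k (partition_diagram P)].

Local Open Scope ring_scope.

Definition multinom (N : nat) (x y w : int) : rat :=
  if [&& 0 <= x, 0 <= y, 0 <= w & x + y + w == N%:Z]
  then (N`!)%:R / ((`|x|%N)`!%:R * (`|y|%N)`!%:R * (`|w|%N)`!%:R)
  else 0.

(* Main.v *)
Require Import Defs.
From mathcomp Require Import all_boot all_order all_algebra.
From mathcomp Require Import ring zify.
Import Order.TTheory GRing.Theory Num.Theory.
Set Implicit Arguments.
Unset Strict Implicit.

(* A 3-nonnesting open diagram of size n+1 arises from a unique one of size n
   by adding a last vertex that may start a semi-arc and may close a semi-arc.
   Suppose there are i semi-arcs; the j of them that belong to a future
   2-nesting are the leftmost ones.  The semi-arc of rank l (counted from 0)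
   can be closed iff j <= l, after which l semi-arcs belong to future
   2-nestings, or l = 0 < j, after which j - 1 do.

   For this generating tree the kernel method amounts to giving the state (i, j)
   the weight (s + t)^(i-j) (s^(j+1) - t^(j+1)): one step of the tree then
   multiplies weights by (1 + s + t)(1 + 1/s + 1/t), up to the error term
   (1 + s + t)(s^(i+1)/t - t^(i+1)/s), which depends only on i.  The coefficient
   of s in a weight is 1 for (i, j) = (0, 0) and 0 otherwise, so telescoping over
   the n steps expresses A_{0,0}(n) by coefficients of products of powers of
   the two trinomials. *)

(** * Nestings, and extension of a diagram by one vertex *)

Lemma opdP n (D : diagram n) :
  reflect [/\ forall x y : 'I_n, (x, y) \in arcs D -> x < y,
              forall x y z : 'I_n, (x, y) \in arcs D -> (x, z) \in arcs D -> y = z,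
              forall x y : 'I_n, (x, y) \in arcs D -> x \notin semiarcs D
            & forall x y z : 'I_n, (x, z) \in arcs D -> (y, z) \in arcs D -> x = y]
          (open_partition_diagram D).
Proof.
apply: (iffP and3P) => [[/forallP h1 /forallP h2 /forallP h3]|[h1 h2 h3 h4]].
  have arc_l x y : (x, y) \in arcs D -> 0 < #|[set e in arcs D | e.1 == x]|.
    by move=> xy; apply/card_gt0P; exists (x, y); rewrite inE xy eqxx.
  split=> [x y xy|x y z xy xz|x y xy|x y z xz yz].
  - by have /implyP := h1 (x, y); apply.
  - have /(leq_trans (leq_addr _ _))/card_le1_eqP := h2 x.
    by move=> /(_ (x, y) (x, z)); rewrite !inE xy xz eqxx => /(_ isT isT) [].
  - have := h2 x; have := arc_l _ _ xy.
    by case: (x \in _) => //; lia.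
  - have /card_le1_eqP := h3 z.
    by move=> /(_ (x, z) (y, z)); rewrite !inE xz yz eqxx => /(_ isT isT) [].
split; apply/forallP.
- by move=> [x y]; apply/implyP => /h1.
- move=> x; case: (boolP (x \in semiarcs D)) => hx.
    rewrite leq_eqVlt addn1 eqSS cards_eq0; apply/orP; left; apply/eqP/setP => -[y z].
    by rewrite !inE /=; apply/negP => /andP[/h3/negP hy /eqP e]; apply: hy; rewrite e.
  rewrite addn0; apply/card_le1_eqP => -[y z] [y' z'].
  rewrite !inE /= => /andP[a /eqP yx] /andP[b /eqP y'x].
  subst; congr (_, _); apply: h2 b a.
- move=> z; apply/card_le1_eqP => -[y x] [y' x'].
  rewrite !inE /= => /andP[a /eqP yx] /andP[b /eqP y'x].
  by subst; congr (_, _); apply: h4 b a.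
Qed.

Definition nested n (e f : 'I_n * 'I_n) := (e.1 < f.1) && (f.2 < e.2).

(** In the increasing list of end-points, the outer comparisons are the two [nested] conditions; the
    middle one says that the innermost arc goes from left to right, as every arc does. *)
Lemma has_nesting3P n (D : diagram n) : open_partition_diagram D ->
  reflect (exists a b c, [/\ a \in arcs D, b \in arcs D, c \in arcs D, nested a b & nested b c])
          (has_nesting 3 D).
Proof.
move=> /opdP[lt_arc _ _ _]; apply: (iffP existsP) => [[t]|].
  case/tupleP: t => a t; case/tupleP: t => b t; case/tupleP: t => c t.
  rewrite (tuple0 t) /is_nesting /= => /andP[/and4P[ha hb hc _] h].
  by exists a, b, c; split=> //; rewrite /nested; lia.
move=> [a [b [[c1 c2] [ha hb hc]]]]; rewrite /nested /= => h1 h2.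
exists [tuple a; b; (c1, c2)]; rewrite /is_nesting /= ha hb hc /=.
by have := lt_arc _ _ hc; lia.
Qed.

Lemma in_future_nesting2P n (D : diagram n) x : open_partition_diagram D ->
  reflect (x \in semiarcs D /\ exists a, a \in arcs D /\ x < a.1)
          (in_future_nesting 2 D x).
Proof.
move=> /opdP[lt_arc _ _ _]; apply: (iffP andP) => [[hx /existsP[t]]|].
  case/tupleP: t => a t; rewrite (tuple0 t) /is_nesting /= => h.
  by split=> //; exists a; split; lia.
move=> [hx [[a1 a2] [ha /= h]]]; split=> //; apply/existsP.
exists [tuple (a1, a2)]; rewrite /is_nesting /= ha h /=.
by have := lt_arc _ _ ha; lia.
Qed.

Lemma in_future_nesting3P n (D : diagram n) x : open_partition_diagram D ->
  reflect (x \in semiarcs D /\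
     exists b c, [/\ b \in arcs D, c \in arcs D, x < b.1 & nested b c])
          (in_future_nesting 3 D x).
Proof.
move=> /opdP[lt_arc _ _ _]; apply: (iffP andP) => [[hx /existsP[t]]|].
  case/tupleP: t => a t; case/tupleP: t => b t.
  rewrite (tuple0 t) /is_nesting /nested /= => h.
  by split=> //; exists a, b; split; lia.
move=> [hx [a [[b1 b2] [ha hb]]]]; rewrite /nested /= => h1 h2; split=> //; apply/existsP.
exists [tuple a; (b1, b2)]; rewrite /is_nesting /= ha hb h1 /=.
by have := lt_arc _ _ hb; lia.
Qed.

(** A semi-arc acts as an arc ending at infinity: over a nested pair, an enclosing arc and a
    semi-arc starting further left are both forbidden. *)
Lemma nonnesting3P n (D : diagram n) : open_partition_diagram D ->
  reflect (forall b c, b \in arcs D -> c \in arcs D -> nested b c ->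
     (forall x, x \in semiarcs D -> ~ x < b.1) /\
     (forall a, a \in arcs D -> ~ nested a b))
   (nonnesting 3 D).
Proof.
move=> oD; apply: (iffP andP) => [[/(has_nesting3P oD) h1 /existsPn h2] b c hb hc hbc|h].
  split=> [x hx lt_x|a ha hab]; last by apply: h1; exists a, b, c.
  by have /(in_future_nesting3P _ oD) := h2 x; apply; split=> //; exists b, c.
split.
  apply/(has_nesting3P oD) => -[a [b [c [ha hb hc hab hbc]]]].
  by have [_ /(_ a ha)] := h _ _ hb hc hbc.
apply/existsPn => x; apply/(in_future_nesting3P _ oD) => -[hx [b [c [hb hc xb hbc]]]].
by have [/(_ x hx)] := h _ _ hb hc hbc.
Qed.

Lemma bump_ord n (x : 'I_n) : bump n x = x.
Proof. by rewrite /bump leqNgt ltn_ord. Qed.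

Definition lift_maxE := (lift_max, bump_ord).

Lemma diagram_eq n (D E : diagram n) :
  arcs D = arcs E -> semiarcs D = semiarcs E -> D = E.
Proof. by case: D E => [a s] [a' s'] /= -> ->. Qed.

Section Extension.
Variable n : nat.
Implicit Types (D : diagram n) (b : bool) (o : option 'I_n) (x y : 'I_n).
Local Notation w := (lift (@ord_max n)).

(** The new vertex is [ord_max]; [b] tells whether it starts a semi-arc, and [o] is the left
    end-point of the semi-arc that it closes, if any. *)
Definition extend D b o : diagram n.+1 :=
  ([set e | match unlift ord_max e.1, unlift ord_max e.2 with
            | Some x, Some y => (x, y) \in arcs D
            | Some x, None => o == Some x
            | None, _ => false
            end],
   [set x | if unlift ord_max x is Some x' then (x' \in semiarcs D) && (o != Some x') else b]).

(** Undoes [extend]: an arc into the deleted vertex is reopened as a semi-arc. *)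
Definition restrict (D : diagram n.+1) : diagram n :=
  ([set e | (w e.1, w e.2) \in arcs D],
   [set x | (w x \in semiarcs D) || ((w x, ord_max) \in arcs D)]).

Lemma extend_arc D b o x y : ((w x, w y) \in arcs (extend D b o)) = ((x, y) \in arcs D).
Proof. by rewrite inE /= !liftK. Qed.

Lemma extend_arc_max D b o x : ((w x, ord_max) \in arcs (extend D b o)) = (o == Some x).
Proof. by rewrite inE /= liftK unlift_none. Qed.

Lemma extend_max_arc D b o (y : 'I_n.+1) : ((ord_max, y) \in arcs (extend D b o)) = false.
Proof. by rewrite inE /= unlift_none. Qed.

Lemma extend_semi D b o x :
  (w x \in semiarcs (extend D b o)) = (x \in semiarcs D) && (o != Some x).
Proof. by rewrite inE /= liftK. Qed.

Lemma extend_semi_max D b o : (ord_max \in semiarcs (extend D b o)) = b.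
Proof. by rewrite inE /= unlift_none. Qed.

Definition extendE := (extend_arc, extend_arc_max, extend_max_arc, extend_semi, extend_semi_max).

(* Otherwise [/=] and unification look through the pair, and [extendE] no longer matches. *)
Global Opaque extend.

Variant extend_arc_spec D b o : 'I_n.+1 * 'I_n.+1 -> Prop :=
  | ExtendOldArc e of e \in arcs D : extend_arc_spec D b o (w e.1, w e.2)
  | ExtendNewArc x of o = Some x : extend_arc_spec D b o (w x, ord_max).

Lemma extend_arcP D b o e : e \in arcs (extend D b o) -> extend_arc_spec D b o e.
Proof.
case: e => x y; case: (unliftP ord_max x) => [x'|] ->; rewrite ?extendE //.
case: (unliftP ord_max y) => [y'|] ->; rewrite ?extendE.
  by move=> h; apply: (@ExtendOldArc _ _ _ (x', y')).
by move/eqP; apply: ExtendNewArc.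
Qed.

Lemma opd_extend D b o : open_partition_diagram D ->
  (forall x, o = Some x -> x \in semiarcs D) ->
  open_partition_diagram (extend D b o).
Proof.
move=> /opdP[h1 h2 h3 h4] ho; apply/opdP; split.
- suff lt_arc e : e \in arcs (extend D b o) -> e.1 < e.2 by move=> x y /lt_arc.
  by case/extend_arcP => [[x y] /h1 lt_xy|x _] /=; rewrite !lift_maxE ?ltn_ord.
- move=> x y z; case: (unliftP ord_max x) => [x'|] ->; rewrite ?extendE //.
  case: (unliftP ord_max y) => [y'|] ->; case: (unliftP ord_max z) => [z'|] ->; rewrite ?extendE //.
  + by move=> a a'; congr w; apply: h2 a a'.
  + by move=> /h3 nx /eqP/ho; rewrite (negPf nx).
  + by move=> /eqP/ho sx /h3; rewrite sx.
- move=> x y; case: (unliftP ord_max x) => [x'|] ->; rewrite ?extendE //.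
  case: (unliftP ord_max y) => [y'|] ->; rewrite ?extendE // => h; last by rewrite h andbF.
  by rewrite (negPf (h3 _ _ h)).
- move=> x y z; case: (unliftP ord_max x) => [x'|] ->; rewrite ?extendE //.
  case: (unliftP ord_max y) => [y'|] ->; case: (unliftP ord_max z) => [z'|] ->; rewrite ?extendE //.
  + by move=> a a'; congr w; apply: h4 a a'.
  + by move=> /eqP -> /eqP[->].
Qed.

Lemma opd_restrict (D : diagram n.+1) : open_partition_diagram D ->
  open_partition_diagram (restrict D).
Proof.
move=> /opdP[h1 h2 h3 h4]; apply/opdP; split=> [x y|x y z|x y|x y z]; rewrite !inE /=.
- by move/h1; rewrite !lift_maxE.
- by move=> a a'; apply: (@lift_inj _ ord_max); apply: h2 a a'.
- move=> a; rewrite negb_or (h3 _ _ a) /=; apply/negP => a'.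
  by have := h2 _ _ _ a a' => /eqP; rewrite eq_sym (negPf (neq_lift _ _)).
- by move=> a a'; apply: (@lift_inj _ ord_max); apply: h4 a a'.
Qed.

Definition closed_semi (D : diagram n.+1) : option 'I_n :=
  [pick x | (w x, ord_max) \in arcs D].

Lemma closed_semiE (D : diagram n.+1) x : open_partition_diagram D ->
  (closed_semi D == Some x) = ((w x, ord_max) \in arcs D).
Proof.
move=> /opdP[_ _ _ h4]; rewrite /closed_semi; case: pickP => [y hy|/(_ x) -> //].
apply/eqP/idP => [[<-] //|hx]; congr Some; apply: (@lift_inj _ ord_max); exact: h4 hy hx.
Qed.

Lemma restrictK (D : diagram n.+1) : open_partition_diagram D ->
  extend (restrict D) (ord_max \in semiarcs D) (closed_semi D) = D.
Proof.
move=> oD; have /opdP[h1 h2 h3 h4] := oD.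
apply: diagram_eq; apply/setP; last first.
  move=> x; case: (unliftP ord_max x) => [x'|] ->; rewrite ?extendE //.
  rewrite closed_semiE // inE.
  by case: (boolP ((w x', ord_max) \in _)) => [/h3/negPf ->|]; rewrite ?orbF ?andbT ?andbF.
move=> [x y]; case: (unliftP ord_max x) => [x'|] ->; last first.
  by rewrite extendE; apply/esym/negbTE/negP => /h1; rewrite ltnNge -ltnS ltn_ord.
case: (unliftP ord_max y) => [y'|] ->; rewrite ?extendE ?closed_semiE //.
by rewrite inE.
Qed.

Lemma extendK D b o : (forall x, o = Some x -> x \in semiarcs D) ->
  restrict (extend D b o) = D.
Proof.
move=> ho; apply: diagram_eq; apply/setP.
  by move=> [x y]; rewrite inE extendE.
move=> x; rewrite inE !extendE.
by case: eqP => [/ho -> //|_]; rewrite andbT orbF.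
Qed.

Lemma closed_semi_extend D b o : closed_semi (extend D b o) = o.
Proof.
rewrite /closed_semi; case: pickP => [x|none]; first by rewrite extendE => /eqP.
by case: o none => // x /(_ x); rewrite extendE eqxx.
Qed.

(** Closing [x] creates an arc around all arcs that start right of [x]. If there is one, a semi-arc
    left of [x] would complete a future 3-nesting, so [x] has to be the leftmost semi-arc. *)
Definition closable D x :=
  (x \in semiarcs D) && (in_future_nesting 2 D x ==> [forall y in semiarcs D, x <= y]).

Definition closable_opt D o := if o is Some x then closable D x else true.

(** A nested pair below the new arc is no new obstruction: it was below the semi-arc now closed.
    What remains is a semi-arc to the left of the new arc when that arc encloses an old one, and
    this is what [closable] excludes. *)
Lemma good_extend D b o : open_partition_diagram D ->
  (forall x, o = Some x -> x \in semiarcs D) ->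
  nonnesting 3 (extend D b o) = nonnesting 3 D && closable_opt D o.
Proof.
move=> oD ho; have oE := opd_extend b oD ho.
apply/(nonnesting3P oE)/andP => [h|[/(nonnesting3P oD) h]].
  split.
    apply/(nonnesting3P oD) => e f he hf hef.
    have [|||h1 h2] := h (w e.1, w e.2) (w f.1, w f.2).
    - by rewrite extendE -surjective_pairing.
    - by rewrite extendE -surjective_pairing.
    - by move: hef; rewrite /nested /= !lift_maxE.
    split=> [x hx|a ha].
      (* If the semi-arc from [x] is the one closed, the forbidden configuration survives as a
         3-nesting whose outer arc ends at [ord_max]. *)
      case: (boolP (o == Some x)) => ox lt_x.
        apply: (h2 (w x, ord_max)); rewrite ?extendE // /nested /= !lift_maxE lt_x /=.
        exact: ltn_ord.
      by apply: (h1 (w x)); rewrite ?extendE ?hx //= !lift_maxE.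
    move=> hae; apply: (h2 (w a.1, w a.2)); first by rewrite extendE -surjective_pairing.
    by move: hae; rewrite /nested /= !lift_maxE.
  case: o ho h {oE} => //= x /(_ _ erefl) hx h; rewrite /closable hx /=.
  apply/implyP => /(in_future_nesting2P _ oD) [_ [a [ha lt_x]]].
  apply/forallP => y; apply/implyP => hy; rewrite leqNgt; apply/negP => lt_yx.
  have [||| h1 _] := h (w x, ord_max) (w a.1, w a.2).
  - by rewrite extendE.
  - by rewrite extendE -surjective_pairing.
  - by rewrite /nested /= !lift_maxE lt_x /= ltn_ord.
  apply: (h1 (w y)); rewrite /= ?lift_maxE // extendE hy /=.
  by apply/eqP => -[exy]; rewrite exy ltnn in lt_yx.
move=> hc e f /extend_arcP he /extend_arcP hf.
(* The inner arc [f] cannot end at the last vertex, because [e] ends strictly later. *)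
case: hf => [f' hf|x ox]; last first.
  case: he => [e' _|x' ox']; rewrite /nested /= ?ltnn ?andbF // !lift_maxE.
  by move=> /andP[_]; rewrite ltnNge ltnW ?ltn_ord.
case: he => [e' he|x ox].
  rewrite {1}/nested /= !lift_maxE => hef; have [h1 h2] := h _ _ he hf hef.
  split.
    move=> y; case: (unliftP ord_max y) => [y'|] ->; rewrite !extendE /= ?lift_maxE.
      by move=> /andP[hy _]; apply: h1.
    by move=> _; apply/negP; rewrite -leqNgt ltnW // ltn_ord.
  move=> a /extend_arcP; case=> [a' ha|x ox]; rewrite /nested /= !lift_maxE; first exact: h2.
  by move=> /andP[lt_x _]; apply: (h1 x) => //; apply: ho.
(* Now [e] is the new arc: [f'] puts [x] in a future 2-nesting, so [x] is the leftmost semi-arc, and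
   no arc ends beyond the last vertex. *)
subst o; rewrite /nested /= !lift_maxE => /andP[lt_x _].
have hx := ho _ erefl.
have le_x y : y \in semiarcs D -> x <= y.
  move: hc; rewrite /= /closable hx /= => /implyP hc hy.
  have /forallP/(_ y)/implyP : [forall y in semiarcs D, x <= y].
    by apply/hc/(in_future_nesting2P _ oD); split=> //; exists f'.
  exact.
split.
  move=> y; case: (unliftP ord_max y) => [y'|] ->; rewrite !extendE /= ?lift_maxE.
    by move=> /andP[/le_x le_y _]; apply/negP; rewrite -leqNgt.
  by move=> _; apply/negP; rewrite -leqNgt ltnW // ltn_ord.
move=> a /extend_arcP; case=> [a' ha|x' ox]; rewrite /nested /= ?ltnn ?andbF // !lift_maxE.
by move=> /andP[_]; rewrite ltnNge ltnW ?ltn_ord.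
Qed.

End Extension.

(** * Set partitions *)

Section Blocks.
Variable n : nat.
Implicit Types (D : diagram n) (P : {set {set 'I_n}}) (x y z : 'I_n).

Definition arc_rel D : rel 'I_n := fun x y => (x, y) \in arcs D.
(** Each vertex has at most one outgoing and one incoming arc, so a block is a single increasing
    path and reachability in one of the two directions suffices. *)
Definition same_block D : rel 'I_n :=
  fun x y => connect (arc_rel D) x y || connect (arc_rel D) y x.
Definition diagram_partition D : {set {set 'I_n}} :=
  equivalence_partition (same_block D) [set: 'I_n].

Lemma connect_leq D x y : open_partition_diagram D -> connect (arc_rel D) x y -> x <= y.
Proof.
move=> /opdP[h1 _ _ _] /connectP[p]; elim: p x => [|z p IH] x /=; first by move=> _ ->.
by move=> /andP[/h1 lt_xz /IH h] /h; apply: leq_trans; apply: ltnW.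
Qed.

Lemma connect_step D x y : connect (arc_rel D) x y -> x != y ->
  exists2 z, arc_rel D x z & connect (arc_rel D) z y.
Proof.
move=> /connectP[[|z p] /= hp ey]; first by rewrite ey eqxx.
by move=> _; case/andP: hp => xz hp; exists z => //; apply/connectP; exists p.
Qed.

(** At most one arc leaves each vertex, so of two paths from [x] one is a prefix of the other. *)
Lemma connect_fork D x y z : open_partition_diagram D ->
  connect (arc_rel D) x y -> connect (arc_rel D) x z -> same_block D y z.
Proof.
move=> /opdP[_ h2 _ _] /connectP[p]; elim: p x => [|t p IH] x /=.
  by move=> _ -> xz; rewrite /same_block xz.
move=> /andP[xt hp] ey xz; have [exz|nxz] := eqVneq x z.
  rewrite /same_block -exz orbC; apply/orP; left; apply/connectP.
  by exists (t :: p) => //=; rewrite xt.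
have [t' xt' t'z] := connect_step xz nxz.
by rewrite (h2 _ _ _ xt' xt) in t'z; apply: IH t'z.
Qed.

(** Dual of [connect_fork]: at most one arc enters each vertex, so the paths are compared from their
    ends. *)
Lemma connect_join D x y z : open_partition_diagram D ->
  connect (arc_rel D) y x -> connect (arc_rel D) z x -> same_block D y z.
Proof.
move=> oD; have /opdP[h1 _ _ h4] := oD.
move=> /connectP[p]; elim/last_ind: p x => [|p t IH] x /=.
  by move=> _ -> zx; rewrite /same_block zx orbT.
rewrite rcons_path last_rcons => /andP[hp pt] -> {x} /connectP[q].
case/lastP: q => [|q s] /=.
  move=> _ <-; rewrite /same_block; apply/orP; left; apply/connectP.
  by exists (rcons p t); rewrite ?last_rcons ?rcons_path ?hp.
rewrite rcons_path last_rcons => /andP[hq qs] ets; rewrite -ets in qs.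
apply: (IH (last y p)) => //; apply/connectP; exists q => //; exact: h4 pt qs.
Qed.

Lemma same_block_equiv D : open_partition_diagram D -> equivalence_rel (same_block D).
Proof.
move=> oD; have sym x y : same_block D x y = same_block D y x by rewrite /same_block orbC.
have tr : transitive (same_block D).
  move=> y x z; rewrite {1 2}/same_block => /orP[xy|yx] /orP[yz|zy].
  - by rewrite /same_block (connect_trans xy yz).
  - exact: connect_join xy zy.
  - exact: connect_fork yx yz.
  - by rewrite /same_block (connect_trans zy yx) orbT.
apply/equivalence_relP; split=> [x|x y xy z]; first by rewrite /same_block connect0.
by apply/idP/idP => [xz|yz]; [apply: tr xz; rewrite sym | apply: tr yz].
Qed.

Lemma diagram_partitionP D : open_partition_diagram D ->
  partition (diagram_partition D) [set: 'I_n].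
Proof.
move=> oD; apply: equivalence_partitionP => x y z _ _ _.
exact: same_block_equiv.
Qed.

Definition consecutive P x y :=
  [exists B in P, [&& x \in B, y \in B, x < y & [forall z in B, ~~ (x < z < y)]]].

Lemma mem_partition_diagram P x y :
  ((x, y) \in arcs (partition_diagram P)) = consecutive P x y.
Proof. by rewrite inE. Qed.

Lemma partition_diagramE P x y : partition P [set: 'I_n] ->
  ((x, y) \in arcs (partition_diagram P)) =
  [&& y \in pblock P x, x < y & [forall z in pblock P x, ~~ (x < z < y)]].
Proof.
move=> /and3P[/eqP cP tP _]; have inP z : z \in pblock P z by rewrite mem_pblock cP.
rewrite mem_partition_diagram; apply/exists_inP/idP => [[B BP /and4P[xB]]|h].
  by rewrite (def_pblock tP BP xB) => -> -> ->.
by exists (pblock P x); rewrite ?pblock_mem ?cP // inP.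
Qed.

Lemma opd_partition_diagram P : partition P [set: 'I_n] ->
  open_partition_diagram (partition_diagram P).
Proof.
move=> pP; have /and3P[/eqP cP tP _] := pP; apply/opdP; split=> [x y|x y z|x y|x y z].
- by rewrite partition_diagramE // => /and3P[].
- rewrite !partition_diagramE // => /and3P[yx lt_xy /forall_inP hy] /and3P[zx lt_xz /forall_inP hz].
  by apply/val_inj/eqP; have := hy _ zx; have := hz _ yx; rewrite /= lt_xy lt_xz; lia.
- by move=> _; rewrite /semiarcs /= in_set0.
- rewrite !partition_diagramE // => /and3P[zx lt_x /forall_inP hx] /and3P[zy lt_y /forall_inP hy].
  have inP t : t \in pblock P t by rewrite mem_pblock cP.
  have exy : pblock P x = pblock P y.
    by rewrite -(same_pblock tP zx) -(same_pblock tP zy).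
  (* Neither of [x] and [y] lies strictly between the other one and [z], so they coincide. *)
  have := hx y; have := hy x; rewrite exy -{1}exy !inP lt_x lt_y => /(_ isT) h1 /(_ isT) h2.
  by apply/val_inj/eqP; move: h1 h2 => /=; lia.
Qed.

Lemma same_block_partition P x y : partition P [set: 'I_n] ->
  same_block (partition_diagram P) x y = (y \in pblock P x).
Proof.
move=> pP; have /and3P[/eqP cP tP _] := pP.
have inP t : t \in pblock P t by rewrite mem_pblock cP.
have sym s t : (t \in pblock P s) = (s \in pblock P t).
  by rewrite -!eq_pblock ?cP ?inE // eq_sym.
have sub s t : connect (arc_rel (partition_diagram P)) s t -> t \in pblock P s.
  move=> /connectP[p]; elim: p s => [|r p IH] s /=; first by move=> _ ->.
  rewrite {1}/arc_rel partition_diagramE // => /andP[/and3P[rs _ _] hp] et.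
  by rewrite -(same_pblock tP rs); apply: IH.
apply/orP/idP => [[/sub //|/sub]|]; first by rewrite sym.
wlog le_xy : x y / x <= y.
  by move=> h; case/orP: (leq_total x y) => [/h //|/h]; rewrite sym or_comm.
(* Induction on a bound [k] for the distance: a block element strictly between splits the path, and
   without one [(x, y)] is an arc. *)
move=> yx; left; move: {2}(y - x) (leqnn (y - x)) => k.
elim: k x y le_xy yx => [|k IH] x y le_xy yx le_k.
  by have -> : x = y by apply/val_inj => /=; lia.
have [->|neq_xy] := eqVneq x y; first exact: connect0.
have lt_xy : x < y by rewrite ltn_neqAle neq_xy.
case: (boolP [forall z in pblock P x, ~~ (x < z < y)]) => h.
  by apply: connect1; rewrite /arc_rel partition_diagramE // yx lt_xy.
move: h; rewrite negb_forall => /existsP[z]; rewrite negb_imply negbK => /and3P[zx lt_xz lt_zy].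
apply: (connect_trans (y := z)); apply: IH => //; try lia.
by rewrite (same_pblock tP zx).
Qed.

Lemma partition_diagramK P : partition P [set: 'I_n] ->
  diagram_partition (partition_diagram P) = P.
Proof.
move=> pP; rewrite -[RHS](equivalence_partition_pblock pP).
rewrite /diagram_partition /equivalence_partition.
by apply: eq_imset => x; apply/setP => y; rewrite !inE same_block_partition.
Qed.

Lemma diagram_partitionK D : open_partition_diagram D -> semiarcs D = set0 ->
  partition_diagram (diagram_partition D) = D.
Proof.
move=> oD sD; have pP := diagram_partitionP oD.
have /opdP[h1 h2 _ _] := oD.
have mem_block x y : (y \in pblock (diagram_partition D) x) = same_block D x y.
  by rewrite pblock_equivalence_partition ?inE // => a b c _ _ _; apply: same_block_equiv.
apply: diagram_eq; last by rewrite sD.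
apply/setP => -[x y]; rewrite partition_diagramE // mem_block.
apply/and3P/idP => [[xy lt_xy /forall_inP h]|xy].
  have cxy : connect (arc_rel D) x y.
    by case/orP: xy => // /(connect_leq oD); rewrite leqNgt lt_xy.
  have [|z xz zy] := connect_step cxy; first by apply: contraTneq lt_xy => ->; rewrite ltnn.
  have /h : z \in pblock (diagram_partition D) x by rewrite mem_block /same_block connect1.
  have := connect_leq oD zy; rewrite (h1 _ _ xz) /= -leqNgt => le1 le2.
  by have -> : y = z by apply/val_inj/eqP; rewrite eqn_leq le1 le2.
split; [by rewrite /same_block connect1 | exact: h1 |].
apply/forall_inP => z; rewrite mem_block => xz; apply/negP => /andP[lt_xz lt_zy].
have cxz : connect (arc_rel D) x z.
  by case/orP: xz => // /(connect_leq oD); rewrite leqNgt lt_xz.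
have [|t xt tz] := connect_step cxz; first by apply: contraTneq lt_xz => ->; rewrite ltnn.
by have := connect_leq oD tz; rewrite (h2 _ _ _ xt xy) leqNgt lt_zy.
Qed.

End Blocks.

Lemma card_nonnesting_partitions n : #|nonnesting_partitions 3 n| = A 0 0 n.
Proof.
rewrite /A -(card_in_imset (f := @partition_diagram n)); last first.
  move=> P Q; rewrite !inE => /andP[pP _] /andP[pQ _] /(congr1 (@diagram_partition n)).
  by rewrite !partition_diagramK.
apply: eq_card => D; apply/imsetP/idP => [[P]|].
  rewrite [P \in _]inE => /andP[pP nP] ->; rewrite inE nP opd_partition_diagram //= cards0 eqxx /=.
  by rewrite cards_eq0; apply/eqP/setP => x; rewrite !inE /in_future_nesting inE.
rewrite inE => /and4P[oD nD]; rewrite cards_eq0 => /eqP sD _.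
exists (diagram_partition D); last by rewrite diagram_partitionK.
by rewrite inE diagram_partitionP //= diagram_partitionK.
Qed.

(** * The generating tree *)

(** The ranks in [A] are 0, ..., [#|A| - 1]: removing the maximum removes the top rank and keeps the
    others. *)
Lemma sum_rank n (V : nmodType) (g : nat -> V) (A : {set 'I_n}) :
  (\sum_(x in A) g #|[set y in A | (y < x)%N]| = \sum_(0 <= l < #|A|) g l)%R.
Proof.
move: {2}#|A| (erefl #|A|) => k; elim: k A => [|k IH] A cA.
  by move/eqP: (cA); rewrite cards_eq0 => /eqP ->; rewrite cards0 big_set0 big_geq.
have /card_gt0P[x0 x0A] : 0 < #|A| by rewrite cA.
pose m := [arg max_(x > x0 in A) (x : nat)].
have [mA max_m] : m \in A /\ forall y, y \in A -> y <= m by rewrite /m; case: arg_maxnP.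
have cA' : #|A :\ m| = k by have := cardsD1 m A; rewrite mA cA => -[->].
rewrite (big_setD1 m) //= cA big_nat_recr //= [RHS]addrC; congr (_ + _)%R.
  rewrite -cA'; congr g; apply: eq_card => y; rewrite !inE andbC.
  case: (boolP (y \in A)) => yA; rewrite ?andbF // !andbT.
  by rewrite ltn_neqAle max_m // andbT.
rewrite -cA' -IH //; apply: eq_bigr => x /setD1P[x_m xA].
congr g; apply: eq_card => y; rewrite !inE.
case: (eqVneq y m) => [->|] //=; rewrite andbC; apply/negbTE.
by rewrite negb_and -leqNgt max_m.
Qed.

Definition future n (D : diagram n) := [set x | in_future_nesting 2 D x].
Definition good n := [set D : diagram n | open_partition_diagram D && nonnesting 3 D].
Definition semirank n (D : diagram n) (x : 'I_n) := #|[set y in semiarcs D | y < x]|.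

Lemma future_semi n (D : diagram n) : future D \subset semiarcs D.
Proof. by apply/subsetP => x; rewrite inE => /andP[]. Qed.

(** An arc that starts right of [x] also starts right of every vertex before [x]. So the semi-arcs
    in future 2-nestings form an initial segment, and the rank decides membership. *)
Lemma mem_future n (D : diagram n) x : open_partition_diagram D -> x \in semiarcs D ->
  (x \in future D) = (semirank D x < #|future D|).
Proof.
move=> oD hx; have down y : y \in semiarcs D -> y <= x -> x \in future D -> y \in future D.
  move=> hy le_yx; rewrite !inE => /(in_future_nesting2P _ oD)[_ [a [ha lt_x]]].
  by apply/in_future_nesting2P => //; split=> //; exists a; rewrite (leq_ltn_trans le_yx).
case: (boolP (x \in future D)) => fx.
  apply/esym/proper_card/properP; split.
    by apply/subsetP => y; rewrite inE => /andP[hy lt_y]; apply: down => //; apply: ltnW.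
  by exists x => //; rewrite inE ltnn andbF.
apply/esym/negbTE; rewrite -leqNgt; apply/subset_leq_card/subsetP => y fy.
have hy := subsetP (future_semi D) _ fy; rewrite inE hy ltnNge.
apply: contra fx => le_xy; move: fy; rewrite !inE => /(in_future_nesting2P _ oD)[_ [a [ha lt_y]]].
by apply/in_future_nesting2P => //; split=> //; exists a; rewrite (leq_ltn_trans le_xy).
Qed.

Lemma closableE n (D : diagram n) x : open_partition_diagram D -> x \in semiarcs D ->
  closable D x = (#|future D| <= semirank D x) || (semirank D x == 0).
Proof.
move=> oD hx; rewrite /closable hx /= implybE.
have -> : in_future_nesting 2 D x = (x \in future D) by rewrite inE.
rewrite mem_future // -leqNgt; congr (_ || _); rewrite cards_eq0.
apply/forallP/eqP => [h|/setP h y].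
  apply/setP => y; rewrite !inE; apply/negP => /andP[hy].
  by have /implyP/(_ hy) := h y; rewrite leqNgt => /negP.
by apply/implyP => hy; have := h y; rewrite !inE hy /= => lt_yx; rewrite leqNgt lt_yx.
Qed.

Section States.
Variable n : nat.
Implicit Types (D : diagram n) (b : bool) (o : option 'I_n) (x y : 'I_n).
Local Notation w := (lift (@ord_max n)).

Lemma card_lift_imset (A : {set 'I_n}) b (B : {set 'I_n.+1}) :
  (forall x, (w x \in B) = (x \in A)) -> (ord_max \in B) = b -> #|B| = #|A| + b.
Proof.
move=> hA hb; rewrite (cardsD1 ord_max) hb addnC; congr (_ + _).
rewrite -(card_imset A (@lift_inj _ ord_max)); apply: eq_card => y.
case: (unliftP ord_max y) => [x|] ->; rewrite !inE.
  by rewrite mem_imset ?hA 1?eq_sym ?neq_lift //; apply: lift_inj.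
by rewrite eqxx; apply/esym/negP => /imsetP[x _ /eqP]; rewrite (negPf (neq_lift _ _)).
Qed.

Lemma card_semi_extend D b o : (forall x, o = Some x -> x \in semiarcs D) ->
  #|semiarcs (extend D b o)| = (if o is Some x then #|semiarcs D|.-1 else #|semiarcs D|) + b.
Proof.
move=> ho; rewrite (@card_lift_imset (semiarcs D :\: [set x | o == Some x]) b).
- congr (_ + _); case: o ho => [x /(_ x erefl) hx|_].
    rewrite (cardsD1 x (semiarcs D)) hx /=; apply: eq_card => y.
    by rewrite !inE [Some x == _]eq_sym.
  by apply: eq_card => y; rewrite !inE.
- by move=> x; rewrite extendE !inE andbC.
- by rewrite extendE.
Qed.

Lemma mem_future_extend D b o x : open_partition_diagram D ->
  (forall x, o = Some x -> x \in semiarcs D) ->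
  (w x \in future (extend D b o)) =
  [&& x \in semiarcs D, o != Some x & (x \in future D) || (if o is Some z then x < z else false)].
Proof.
move=> oD ho; have oE := opd_extend b oD ho.
rewrite !inE; apply/(in_future_nesting2P _ oE)/and3P; rewrite extendE.
  move=> [/andP[hx ->] [a []]] /extend_arcP; case=> [a' ha|z ->] /=; rewrite !lift_maxE => lt_x.
    split=> //; apply/orP; left; apply/(in_future_nesting2P _ oD); split=> //.
    by exists a'.
  by split=> //; rewrite lt_x orbT.
move=> [hx -> hf]; rewrite hx; split=> //; case/orP: hf.
  move=> /(in_future_nesting2P _ oD) [_ [a [ha lt_x]]]; exists (w a.1, w a.2).
  by rewrite extendE -surjective_pairing !lift_maxE.
case: o {ho oE} => // z lt_x; exists (w z, ord_max).
by rewrite extendE !lift_maxE eqxx.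
Qed.

Lemma ord_max_notin_future (D : diagram n.+1) : open_partition_diagram D ->
  (ord_max \in future D) = false.
Proof.
move=> oD; rewrite inE; apply/negP => /(in_future_nesting2P _ oD)[_ [a [_ /=]]].
by rewrite ltnNge -ltnS ltn_ord.
Qed.

Lemma card_future_extend_none D b : open_partition_diagram D ->
  #|future (extend D b None)| = #|future D|.
Proof.
move=> oD; rewrite (@card_lift_imset (future D) false) ?addn0 //.
  move=> x; rewrite mem_future_extend //= orbF; apply: andb_idl.
  exact: (subsetP (future_semi D)).
by rewrite ord_max_notin_future ?opd_extend.
Qed.

(** If [x] is in no future 2-nesting, the semi-arcs that are lie to its left, and the new arc adds
    all others on the left. Otherwise [x] is the leftmost semi-arc, so the new arc adds nothing and
    only [x] is lost. *)
Lemma card_future_extend_some D b x : open_partition_diagram D ->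
  closable D x ->
  #|future (extend D b (Some x))| =
  if #|future D| <= semirank D x then semirank D x else #|future D|.-1.
Proof.
move=> oD hc; have hx : x \in semiarcs D by case/andP: hc.
have ho z : Some x = Some z -> z \in semiarcs D by case=> <-.
rewrite leqNgt -mem_future //; case: ifPn; rewrite ?negbK => fx.
  rewrite (@card_lift_imset [set y in semiarcs D | y < x] false) ?addn0 //.
    move=> y; rewrite mem_future_extend // [RHS]inE; congr (_ && _).
    rewrite (inj_eq Some_inj) eq_sym; apply/andP/idP => [[ny]|lt_yx]; last first.
      by rewrite lt_yx orbT; split=> //; apply: contraTneq lt_yx => ->; rewrite ltnn.
    case/orP=> // fy; rewrite ltnNge; apply: contra fx => le_xy.
    move: fy; rewrite !inE => /(in_future_nesting2P _ oD)[_ [a [ha lt_y]]].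
    by apply/in_future_nesting2P => //; split=> //; exists a; rewrite (leq_ltn_trans le_xy).
  by rewrite ord_max_notin_future ?opd_extend.
rewrite (cardsD1 x (future D)) fx /=.
rewrite (@card_lift_imset (future D :\ x) false) ?addn0 //.
  move=> y; rewrite mem_future_extend // !inE (inj_eq Some_inj) [x == y]eq_sym.
  case: (eqVneq y x) => [_|ny] /=; rewrite ?andbF //.
  have [hy|hy] /= := boolP (y \in semiarcs D); last first.
    by apply/esym/negP => /andP[]; rewrite (negPf hy).
  have := hc; rewrite closableE // => /orP[]; first by rewrite leqNgt -mem_future // fx.
  rewrite cards_eq0 => /eqP/setP/(_ y); rewrite !inE hy /= => ->.
  by rewrite orbF.
by rewrite ord_max_notin_future ?opd_extend.
Qed.

End States.

(** The left side is the range condition that [reindex_onto] produces in [good_recurrence]. *)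
Lemma good_extend_closable n (D : diagram n) b o :
  (extend D b o \in good n.+1)
    && ((restrict (extend D b o), (ord_max \in semiarcs (extend D b o), closed_semi (extend D b o)))
        == (D, (b, o)))
  = (D \in good n) && closable_opt D o.
Proof.
rewrite !xpair_eqE closed_semi_extend extend_semi_max !eqxx !andbT ![_ \in good _]inE.
apply/andP/andP => [[/andP[oE gE] /eqP eD]|[/andP[oD gD] hc]].
  have oD : open_partition_diagram D by rewrite -eD opd_restrict.
  have ho x : o = Some x -> x \in semiarcs D.
    by move=> ox; rewrite -eD inE !extendE ox eqxx orbT.
  by move: gE; rewrite good_extend // oD => /andP[-> ->].
have ho x : o = Some x -> x \in semiarcs D by move=> ox; move: hc; rewrite ox => /andP[].
by rewrite opd_extend // good_extend // gD hc extendK.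
Qed.

Lemma good_recurrence n (V : nmodType) (F : nat -> nat -> V) :
  (\sum_(E in good n.+1) F #|semiarcs E| #|future E| =
   \sum_(D in good n) \sum_(b : bool)
     (F (#|semiarcs D| + b)%N #|future D|
      + \sum_(0 <= l < #|semiarcs D|)
          if (#|future D| <= l)%N then F (#|semiarcs D|.-1 + b)%N l
          else if l == 0%N then F (#|semiarcs D|.-1 + b)%N #|future D|.-1 else 0))%R.
Proof.
rewrite (reindex_onto (fun t : diagram n * (bool * option 'I_n) => extend t.1 t.2.1 t.2.2)
   (fun E => (restrict E, (ord_max \in semiarcs E, closed_semi E)))) /=; last first.
  by move=> E; rewrite inE => /andP[oE _]; apply: restrictK.
rewrite (eq_bigl (fun t => (t.1 \in good n) && closable_opt t.1 t.2.2)); last first.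
  by case=> D [b o] /=; rewrite good_extend_closable.
rewrite -(pair_big_dep (mem (good n)) (fun D s => closable_opt D s.2)
  (fun D s => F #|semiarcs (extend D s.1 s.2)| #|future (extend D s.1 s.2)|)) /=.
apply: eq_bigr => D; rewrite inE => /andP[oD _].
rewrite -(pair_big_dep predT (fun b o => closable_opt D o)
  (fun b o => F #|semiarcs (extend D b o)| #|future (extend D b o)|)) /=.
apply: eq_bigr => b _.
(* Closing nothing gives the first summand; the choices [Some x] are then listed by the rank of
   [x]. *)
rewrite (bigD1 None) //= card_semi_extend // card_future_extend_none //; congr (_ + _)%R.
rewrite (reindex_omap Some id) /=; last by case.
rewrite -sum_rank [LHS]big_mkcond [RHS]big_mkcond; apply: eq_bigr => x _.
rewrite eqxx !andbT; case: (boolP (x \in semiarcs D)) => hx; last first.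
  by rewrite /closable (negPf hx).
rewrite -/(semirank D x); case: (boolP (closable D x)) => hc.
  rewrite card_semi_extend => [|_ [<-] //]; rewrite card_future_extend_some //.
  case: ifP => // nle; have := hc; rewrite closableE // nle /= => ->.
  by [].
by move: hc; rewrite closableE // negb_or => /andP[/negPf -> /negPf ->].
Qed.

Local Open Scope ring_scope.

(** * The kernel *)

Section Kernel.
Variable R : comNzRingType.
Variables s t : R.
Let u := s + t.

Definition weight (i j : nat) : R := (s + t) ^+ (i - j) * (s ^+ j.+1 - t ^+ j.+1).

(** The sequence v_m = s^m - t^m satisfies u v_(m+1) = v_(m+2) + s t v_m; this is that relation
    unrolled d + 1 times from m = j. *)
Lemma kernel_identity_aux (j d : nat) :
  u ^+ d.+1 * (s ^+ j.+1 - t ^+ j.+1) =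
  s * t * (u ^+ d * (s ^+ j - t ^+ j)
           + \sum_(j <= l < j + d) u ^+ (j + d - l).-1 * (s ^+ l.+1 - t ^+ l.+1))
  + (s ^+ (j + d).+2 - t ^+ (j + d).+2).
Proof.
elim: d => [|d IH].
  by rewrite addn0 big_geq // /u !exprS; ring.
rewrite exprS -mulrA IH addnS big_nat_recr ?leq_addr //= subSnn expr0 mul1r.
(* Since [l < j + d], the predecessor in the exponent is not truncated, and the exponent grows by
   one with [d]. *)
have -> : \sum_(j <= l < j + d) u ^+ ((j + d).+1 - l).-1 * (s ^+ l.+1 - t ^+ l.+1)
  = u * \sum_(j <= l < j + d) u ^+ (j + d - l).-1 * (s ^+ l.+1 - t ^+ l.+1).
  rewrite mulr_sumr !big_nat; apply: eq_bigr => l /andP[_ lt_l].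
  by rewrite subSn 1?ltnW //= mulrA -exprS prednK ?subn_gt0.
move: (\sum_(_ <= l < _) _) => S.
by rewrite /u !exprS; ring.
Qed.

(** Starting a semi-arc multiplies weights by [s + t], so the children give [1 + s + t] times the
    sum of [weight i j] and the bracket of [kernel_identity_aux]. The factor [s * t] clears the
    denominators of 1 + 1/s + 1/t. *)
Lemma kernel_identity (i j : nat) : (j <= i)%N ->
  s * t * (weight i j + weight i.+1 j
    + \sum_(b <- [:: 0%N; 1%N])
        ((if j is j'.+1 then weight (i.-1 + b) j' else 0)
         + \sum_(j <= l < i) weight (i.-1 + b) l))
  = (1 + s + t) * (s * t + s + t) * weight i j
    - (1 + s + t) * (s ^+ i.+2 - t ^+ i.+2).
Proof.
move=> /subnKC <-; move: (i - j)%N => d.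
have E b : \sum_(j <= l < j + d) weight ((j + d).-1 + b) l
  = u ^+ b * \sum_(j <= l < j + d) u ^+ (j + d - l).-1 * (s ^+ l.+1 - t ^+ l.+1).
  rewrite mulr_sumr !big_nat; apply: eq_bigr => l /andP[_ lt_l].
  by rewrite /weight mulrA -exprD; congr (_ ^+ _ * _); lia.
(* For [j = 0] the right side vanishes because s^0 = t^0, in agreement with the missing child. *)
have E' b : (if j is j'.+1 then weight ((j + d).-1 + b) j' else 0)
  = u ^+ b * (u ^+ d * (s ^+ j - t ^+ j)).
  case: j {E} => [|j]; first by rewrite subrr !mulr0.
  by rewrite /weight mulrA -exprD; congr (_ ^+ _ * _); lia.
rewrite !big_cons big_nil !E !E' expr0 expr1 /weight subSn ?leq_addr // addKn !(exprS _ d).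
have := kernel_identity_aux j d; rewrite !(exprS _ d) /u.
move: (\sum_(_ <= l < _) _) => S; set U := (s + t) ^+ d.
set Dj := (s ^+ j - _); set Dj1 := (s ^+ j.+1 - _); set Di := (s ^+ _.+2 - _) => H.
have -> : Di = (s + t) * U * Dj1 - s * t * (U * Dj + S) by rewrite H; ring.
by ring.
Qed.

End Kernel.

Arguments weight {R} s t i j.

(** * Coefficients of products of trinomials *)

Lemma multinom_bin (p q r : nat) :
  multinom (p + q + r) p q r = ('C(p + q + r, p) * 'C(q + r, q))%:R.
Proof.
rewrite /multinom !lez_nat !leq0n -!PoszD eqxx /= natrM.
have fne k : (k`!)%:R != 0 :> rat by rewrite pnatr_eq0 -lt0n fact_gt0.
have := bin_fact (leq_addr (q + r) p); have := bin_fact (leq_addr r q).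
rewrite !addKn addnA => /(congr1 (GRing.natmul (1 : rat))) E1.
move=> /(congr1 (GRing.natmul (1 : rat))) <-.
move: E1; rewrite !natrM => <-.
have := fne p; have := fne q; have := fne r.
move: (_`!%:R) (_`!%:R) (_`!%:R) => x y z hx hy hz.
by field; rewrite hx hy hz.
Qed.

Lemma multinom_swap (N : nat) (x y w : int) : multinom N x y w = multinom N x w y.
Proof.
rewrite /multinom [x + w + y]addrAC.
by case: (0 <= x) (0 <= y) (0 <= w) => -[] [] //=; rewrite mulrAC.
Qed.

Lemma multinom_swap12 (N : nat) (x y w : int) : multinom N x y w = multinom N y x w.
Proof.
rewrite /multinom [y + x]addrC.
by case: (0 <= x) (0 <= y) (0 <= w) => -[] [] //=; rewrite [_ * (absz y)`!%:R]mulrC.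
Qed.

(** Replacing y! w! by (y+1)! (w-1)! costs the factor w / (y+1); the quotients in the theorem arise
    this way. *)
Lemma multinom_shift (N : nat) (x y w : int) : 0 <= y ->
  multinom N x (y + 1) (w - 1) = multinom N x y w * (w%:~R / (y%:~R + 1)).
Proof.
move=> y0; rewrite /multinom.
have -> : x + (y + 1) + (w - 1) = x + y + w by ring.
(* For [w <= 0] the left side has a negative entry; on the right, either the factor [w] or the
   multinomial is 0. *)
have [w1|w1] := ltrP 0 w; last first.
  have -> : (0 <= w - 1) = false by lia.
  rewrite !andbF; case: ifP; rewrite ?mul0r // => /and4P[_ _ w0 _].
  by rewrite (_ : w = 0) ?mul0r ?mulr0 //; lia.
have -> : (0 <= y + 1) = true by lia.
have -> : (0 <= w - 1) = true by lia.
rewrite y0 (ltW w1) /=; case: ifP => _; last by rewrite mul0r.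
have -> : absz (y + 1) = `|y|%N.+1 by lia.
have -> : `|w|%N = (absz (w - 1)).+1 by lia.
have -> : w%:~R = ((absz (w - 1)).+1)%:R :> rat by rewrite pmulrn; congr (_ %:~R); lia.
have -> : y%:~R = `|y|%N%:R :> rat by rewrite pmulrn; congr (_ %:~R); lia.
have fne k : (k`!)%:R != 0 :> rat by rewrite pnatr_eq0 -lt0n fact_gt0.
have := fne `|y|%N; have := fne `|x|%N; have := fne (absz (w - 1)).
rewrite !factS !natrM !natr1.
have : (`|y|.+1)%:R != 0 :> rat by rewrite pnatr_eq0.
have : ((absz (w - 1)).+1)%:R != 0 :> rat by rewrite pnatr_eq0.
move: (_`!%:R) (_`!%:R) (_`!%:R) (_.+1%:R) (_.+1%:R) => a b c d e.
by move=> ? ? ? ? ?; field; apply/and5P.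
Qed.

Lemma trinomial_expansion (R : comNzRingType) (x y z : R) (N : nat) :
  (x + y + z) ^+ N =
  \sum_(0 <= p < N.+1) \sum_(0 <= q < N.+1) \sum_(0 <= r < N.+1 | (p + q + r == N)%N)
    x ^+ p * y ^+ q * z ^+ r *+ ('C(N, p) * 'C(q + r, q)).
Proof.
rewrite -addrA addrC exprDn big_mkord; apply: eq_bigr => p _.
have lepN : (p <= N)%N by rewrite -ltnS.
rewrite addrC exprDn mulr_suml -sumrMnl.
(* For [q > N - p] no [r] fits; for the other [q] only [r = N - p - q] does. *)
rewrite [RHS](big_cat_nat (n := (N - p).+1)) ?ltnS ?leq_subr //=.
rewrite [X in _ = _ + X]big_nat_cond [X in _ = _ + X]big1 ?addr0; last first.
  move=> q /andP[/andP[lq _] _]; rewrite big_nat_cond big_pred0 // => r.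
  by apply/negP => /andP[_ /eqP]; lia.
rewrite big_mkord; apply: eq_bigr => q _.
have leqN : (q <= N - p)%N by rewrite -ltnS.
have lt_r : (N - p - q < N.+1)%N by lia.
rewrite big_mkord (big_pred1 (Ordinal lt_r)) /=; last first.
  by move=> r /=; rewrite -val_eqE /=; lia.
rewrite subnKC // [in RHS]mulrnA mulrnAl -!mulrnA (mulnC 'C(N - p, q)).
by congr (_ *+ _); rewrite mulrC [z ^+ _ * _]mulrC mulrA.
Qed.


Local Notation Xs := ('X : {poly {poly rat}}).
Local Notation Xt := (('X : {poly rat})%:P : {poly {poly rat}}).

(** With [Xs] the outer variable s and [Xt] the inner variable t, this is the coefficient of s^x
    t^y. *)
Definition bicoef (x y : nat) (P : {poly {poly rat}}) : rat := (P`_x)`_y.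

Lemma bicoef_sum I (r : seq I) (D : pred I) (F : I -> {poly {poly rat}}) x y :
  bicoef x y (\sum_(i <- r | D i) F i) = \sum_(i <- r | D i) bicoef x y (F i).
Proof. by rewrite /bicoef !coef_sum. Qed.

Lemma bicoefB x y P Q : bicoef x y (P - Q) = bicoef x y P - bicoef x y Q.
Proof. by rewrite /bicoef !coefB. Qed.

Lemma bicoefMn x y P k : bicoef x y (P *+ k) = bicoef x y P *+ k.
Proof. by rewrite /bicoef !coefMn. Qed.

Lemma bicoefMST x y a b P :
  bicoef x y (P * (Xs ^+ a * Xt ^+ b)) =
  if (a <= x)%N && (b <= y)%N then bicoef (x - a) (y - b) P else 0.
Proof.
rewrite /bicoef mulrCA mulrC coefMXn; case: ltnP => //= lax; first by rewrite coef0.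
by rewrite -rmorphXn /= coefMC coefMXn; case: ltnP.
Qed.

Lemma coef_X1_exp (R : nzRingType) i k : (('X + 1 : {poly R}) ^+ i)`_k = 'C(i, k)%:R.
Proof.
rewrite addrC exprDn_comm; last exact/commr_sym/commr1.
rewrite coef_sum; under eq_bigr => j _ do rewrite expr1n mul1r coefMn coefXn.
have [le_ki|lt_ik] := leqP k i.
  rewrite (bigD1 (Ordinal (le_ki : (k < i.+1)%N))) //= eqxx big1 ?addr0 // => j.
  by rewrite -val_eqE /= eq_sym => /negPf ->; rewrite mul0rn.
rewrite bin_small // big1 // => j _.
by rewrite gtn_eqF ?mul0rn // (leq_trans _ lt_ik).
Qed.

(** If s t, s and t are chosen e, f and g times, then e + f = x, e + g = y and e + f + g = m, which
    determines the entries; impossible exponents show up as negative entries. *)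
Lemma bicoef_dual_trinomial m x y :
  bicoef x y ((Xs * Xt + Xs + Xt) ^+ m) =
  multinom m (x%:Z + y%:Z - m%:Z) (m%:Z - y%:Z) (m%:Z - x%:Z).
Proof.
(* In the binomial t + (1 + t) s, the degree in s singles out the summand [i = x]. *)
have -> : Xs * Xt + Xs + Xt = Xt + (('X + 1)%:P : {poly {poly rat}}) * Xs.
  by rewrite polyCD; ring.
rewrite exprDn bicoef_sum.
have E (i : 'I_m.+1) :
  bicoef x y (Xt ^+ (m - i) * ((('X + 1)%:P : {poly {poly rat}}) * Xs) ^+ i *+ 'C(m, i))
  = if (x == i)%N && (m - i <= y)%N then ('C(m, i) * 'C(i, y - (m - i)))%:R else 0.
  rewrite bicoefMn exprMn -!rmorphXn /= mulrA -rmorphM /= /bicoef coefCM coefXn.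
  case: eqP => _; last by rewrite mulr0 coef0 mul0rn.
  rewrite mulr1 mulrC coefMXn; case: ltnP => _; rewrite ?mul0rn //.
  by rewrite coef_X1_exp mulnC natrM mulr_natr.
under eq_bigr => i _ do rewrite E.
have [lt_mx|le_xm] := ltnP m x.
  rewrite big1 => [|i _]; last by rewrite gtn_eqF ?(leq_trans _ lt_mx).
  by rewrite /multinom (_ : (0 <= m%:Z - x%:Z) = false) ?andbF //; lia.
rewrite (bigD1 (Ordinal (le_xm : (x < m.+1)%N))) //= eqxx big1 ?addr0 => [|i]; last first.
  by rewrite -val_eqE /= eq_sym => /negPf ->.
case: leqP => [ge_y|lt_y] /=; last first.
  by rewrite /multinom (_ : (0 <= x%:Z + y%:Z - m%:Z) = false) //; lia.
have [le_ym|lt_my] := leqP y m; last first.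
  rewrite (@bin_small x) ?muln0 /multinom; last by lia.
  by rewrite (_ : (0 <= m%:Z - y%:Z) = false) ?andbF //; lia.
have -> : x%:Z + y%:Z - m%:Z = (x + y - m)%N by lia.
have -> : m%:Z - y%:Z = (m - y)%N by lia.
have -> : m%:Z - x%:Z = (m - x)%N by lia.
rewrite multinom_swap multinom_swap12.
have sum_m : (m - x + (x + y - m) + (m - y) = m)%N by lia.
rewrite -[in multinom m]sum_m multinom_bin sum_m.
have -> : (x + y - m + (m - y) = x)%N by lia.
by rewrite bin_sub // (_ : y - (m - x) = x + y - m)%N //; lia.
Qed.

(** Choosing 1, s, t in the first trinomial p, q, r times leaves the exponents x - q - a and y - r -
    b for the second. *)
Lemma bicoef_trinomial_dual M m a b x y :
  bicoef x y ((1 + Xs + Xt) ^+ M * (Xs * Xt + Xs + Xt) ^+ m * (Xs ^+ a * Xt ^+ b)) =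
  \sum_(0 <= p < M.+1) \sum_(0 <= q < M.+1) \sum_(0 <= r < M.+1 | (p + q + r == M)%N)
    multinom M p q r *
    multinom m (x%:Z + y%:Z - q%:Z - r%:Z - a%:Z - b%:Z - m%:Z)
             (m%:Z + r%:Z + b%:Z - y%:Z) (m%:Z + q%:Z + a%:Z - x%:Z).
Proof.
rewrite trinomial_expansion -mulrA mulr_suml bicoef_sum; apply: eq_bigr => p _.
rewrite mulr_suml bicoef_sum; apply: eq_bigr => q _.
rewrite mulr_suml bicoef_sum; apply: eq_bigr => r /eqP pqr.
rewrite -pqr multinom_bin pqr expr1n mul1r.
have -> : Xs ^+ q * Xt ^+ r *+ ('C(M, p) * 'C(q + r, q))
    * ((Xs * Xt + Xs + Xt) ^+ m * (Xs ^+ a * Xt ^+ b))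
  = (Xs * Xt + Xs + Xt) ^+ m * (Xs ^+ (q + a) * Xt ^+ (r + b)) *+ ('C(M, p) * 'C(q + r, q)).
  by rewrite -mulrnAl !exprD; ring.
rewrite bicoefMn -[LHS]mulr_natl bicoefMST bicoef_dual_trinomial.
congr (_ * _); case: ifP => [/andP[lex ley]|nle].
  by congr multinom; lia.
(* If q + a > x or r + b > y, two entries have the negative sum x - q - a or y - r - b, so
   [multinom] is 0. *)
rewrite /multinom; case: ifP => // /and4P[h1 h2 h3 _].
by move: nle; lia.
Qed.

(** Used on the negative half of a difference of powers of s and t, to align its summands with those
    of the positive half. *)
Lemma sum_trinomial_swap (M : nat) (F : nat -> nat -> nat -> rat) :
  \sum_(0 <= p < M.+1) \sum_(0 <= q < M.+1) \sum_(0 <= r < M.+1 | (p + q + r == M)%N) F p q r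
  = \sum_(0 <= p < M.+1) \sum_(0 <= q < M.+1) \sum_(0 <= r < M.+1 | (p + q + r == M)%N) F p r q.
Proof.
apply: eq_bigr => p _.
rewrite (exchange_big_dep predT) //=.
by apply: eq_bigr => q _; apply: eq_bigl => r; rewrite addnAC.
Qed.

(** [Xs - Xt] is the weight of the state (0, 0), and s^(n+1) t^n is s scaled by (st)^n. The part of
    [Xs] gives the squares, that of [Xt] the quotients through [multinom_shift]. *)
Lemma bicoef_initial (n : nat) :
  bicoef n.+1 n (((1 + Xs + Xt) * (Xs * Xt + Xs + Xt)) ^+ n * (Xs - Xt)) =
  \sum_(0 <= a < n.+1) \sum_(0 <= b < n.+1)
      \sum_(0 <= c < n.+1 | (a + b + c == n)%N)
        multinom n a%:Z b%:Z c%:Z ^+ 2 * (1 - c%:R / (b%:R + 1)).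
Proof.
have -> : Xs - Xt = Xs ^+ 1 * Xt ^+ 0 - Xs ^+ 0 * Xt ^+ 1 by rewrite !expr0 !expr1 mulr1 mul1r.
rewrite exprMn mulrBr bicoefB !bicoef_trinomial_dual [X in _ - X]sum_trinomial_swap.
rewrite -sumrB; apply: eq_bigr => p _; rewrite -sumrB; apply: eq_bigr => q _.
rewrite -sumrB; apply: eq_bigr => r /eqP pqr.
rewrite [multinom n p r q]multinom_swap -mulrBr expr2 -mulrA; congr (_ * _).
rewrite mulrBr mulr1; congr (_ - _).
  by rewrite multinom_swap; congr multinom; lia.
have := @multinom_shift n p q r isT; rewrite !pmulrn => <-.
by congr multinom; lia.
Qed.

(** The second exponent is [M.-1] because the error of one tree step has the factor 1 + s + t but
    not s t + s + t. *)
Lemma bicoef_correction (M i : nat) : (0 < M)%N ->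
  bicoef M.+1 M ((1 + Xs + Xt) ^+ M * (Xs * Xt + Xs + Xt) ^+ M.-1 * (Xs ^+ i.+2 - Xt ^+ i.+2)) =
  - \sum_(0 <= p < M.+1) \sum_(0 <= q < M.+1)
     \sum_(0 <= r < M.+1 | (p + q + r == M)%N)
       multinom M p%:Z q%:Z r%:Z *
       multinom (M - 1) (p%:Z - i%:Z) (q%:Z + i%:Z) (r%:Z - 1) *
       ((r%:R - 1) / (q%:R + i%:R + 1) - 1).
Proof.
move=> M_gt0.
have -> : Xs ^+ i.+2 - Xt ^+ i.+2 = Xs ^+ i.+2 * Xt ^+ 0 - Xs ^+ 0 * Xt ^+ i.+2.
  by rewrite !expr0 mulr1 mul1r.
rewrite mulrBr bicoefB !bicoef_trinomial_dual [X in _ - X]sum_trinomial_swap.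
rewrite -sumrB -sumrN; apply: eq_bigr => p _; rewrite -sumrB -sumrN; apply: eq_bigr => q _.
rewrite -sumrB -sumrN; apply: eq_bigr => r /eqP pqr.
rewrite [multinom M p r q]multinom_swap -mulrBr -mulrN -mulrA; congr (_ * _).
rewrite subn1 opprB mulrBr mulr1; congr (_ - _).
  by rewrite multinom_swap; congr multinom; lia.
have := @multinom_shift M.-1 (p%:Z - i%:Z) (q%:Z + i%:Z) (r%:Z - 1) isT.
rewrite rmorphB rmorphD /= !pmulrn => <-.
by congr multinom; lia.
Qed.

(** The substitution t = 0, called [f] below, turns the weight into s^((i-j)+(j+1)) = s^(i+1). *)
Lemma bicoef_weight i j : (j <= i)%N ->
  bicoef 1 0 (weight Xs Xt i j) = ((i == 0%N) && (j == 0%N))%:R.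
Proof.
move=> le_ji; rewrite /weight /bicoef.
pose f : {rmorphism {poly {poly rat}} -> {poly rat}} := map_poly (coefp 0).
have E (P : {poly {poly rat}}) : P`_1`_0 = (f P)`_1 by rewrite coef_map.
have fX : f Xs = 'X by exact: map_polyX.
have fT : f Xt = 0 by apply: etrans (map_polyC (coefp 0) _) _; rewrite /= coefX polyC0.
rewrite E rmorphM rmorphXn rmorphD rmorphB !rmorphXn fX fT.
rewrite addr0 [0 ^+ _.+1]exprS mul0r subr0 -exprD coefXn.
by congr ((_ : bool)%:R); lia.
Qed.

(** * Telescoping *)

Lemma weight_recurrence (R : comNzRingType) (s t : R) k :
  s * t * \sum_(E in good k.+1) weight s t #|semiarcs E| #|future E| =
  \sum_(D in good k)
    ((1 + s + t) * (s * t + s + t) * weight s t #|semiarcs D| #|future D|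
     - (1 + s + t) * (s ^+ #|semiarcs D|.+2 - t ^+ #|semiarcs D|.+2)).
Proof.
rewrite good_recurrence mulr_sumr; apply: eq_bigr => D _.
have le_fs : (#|future D| <= #|semiarcs D|)%N by apply/subset_leq_card/future_semi.
rewrite -kernel_identity // big_bool big_cons big_cons big_nil /=; congr (_ * _).
move: #|semiarcs D| #|future D| le_fs => i j le_ji.
(* Of the ranks below [j] only rank 0 is closable, and it leads to [j - 1]. *)
have split_sum (F : nat -> R) :
    \sum_(0 <= l < i) (if (j <= l)%N then F l else if l == 0%N then F j.-1 else 0)
  = (if j is j'.+1 then F j' else 0) + \sum_(j <= l < i) F l.
  rewrite (big_cat_nat (n := j)) //=; congr (_ + _); last first.
    by apply: eq_big_nat => l /andP[-> _].
  case: j {le_ji} => [|j]; first by rewrite big_geq.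
  rewrite big_nat_recl // big_nat_cond big1 ?addr0 // => l /andP[/andP[_ lt_lj] _].
  by rewrite ltnS leqNgt lt_lj.
rewrite (split_sum (fun l => weight s t (i.-1 + true)%N l)).
rewrite (split_sum (fun l => weight s t (i.-1 + false)%N l)) !addn0 addn1 /=.
move: (_ + \sum_(_ <= _ < _) _) (_ + \sum_(_ <= _ < _) _) => X Y.
by ring.
Qed.

Lemma sum_good_states (V : nmodType) (F : nat -> nat -> V) k :
  \sum_(D in good k) F #|semiarcs D| #|future D| =
  \sum_(0 <= i < k.+1) \sum_(0 <= j < i.+1) F i j *+ A i j k.
Proof.
have le_sk (D : diagram k) : (#|semiarcs D| < k.+1)%N.
  by rewrite ltnS (leq_trans (max_card _)) ?card_ord.
have le_fs (D : diagram k) : (#|future D| <= #|semiarcs D|)%N.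
  by apply/subset_leq_card/future_semi.
rewrite big_mkord (partition_big (fun D => Ordinal (le_sk D)) predT) //=.
apply: eq_bigr => i _.
rewrite big_mkord (partition_big (fun D => inord #|future D| : 'I_i.+1) predT) //=.
apply: eq_bigr => j _; rewrite /A -sumr_const; apply: eq_big => D.
  rewrite [RHS]inE [D \in good _]inE -!val_eqE -!andbA; congr [&& _, _ & _].
  rewrite [val (Ordinal _)]/=; case: eqP => //= ei.
  by rewrite inordK // ltnS -ei.
move=> /andP[/andP[_ /eqP/(congr1 val) /= ei] /eqP/(congr1 val) /=].
by rewrite inordK => [<-|]; rewrite ?ltnS -ei.
Qed.

Lemma good0 (D : diagram 0) : D \in good 0.
Proof.
have oD : open_partition_diagram D by apply/opdP; split=> -[].
by rewrite inE oD; apply/(nonnesting3P oD) => -[[]].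
Qed.

Lemma sum_good0 (V : nmodType) (F : nat -> nat -> V) :
  \sum_(D in good 0) F #|semiarcs D| #|future D| = F 0%N 0%N.
Proof.
rewrite (eq_bigr (fun=> F 0%N 0%N)) => [|D _]; last first.
  have card0 (X : {set 'I_0}) : #|X| = 0%N.
    by apply/eqP; rewrite -leqn0 -[leqRHS](card_ord 0) max_card.
  by rewrite !card0.
rewrite sumr_const (eq_card (B := predT)) => [|D]; last by rewrite good0.
(* A diagram of size 0 is a pair of subsets of empty types, so there is exactly one. *)
by rewrite card_prod -cardsT -powersetT card_powerset -[X in (_ * X)%N]cardsT -powersetT
  card_powerset !cardsT card_prod !card_ord.
Qed.

(* The coefficient of s in ((1 + s + t)(1 + 1/s + 1/t))^(n - k) times the sum of
   the weights in size k, scaled by (st)^(n - k) to avoid negative exponents. *)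
Definition moment n k : rat :=
  bicoef (n - k).+1 (n - k)
    (((1 + Xs + Xt) * (Xs * Xt + Xs + Xt)) ^+ (n - k)
     * \sum_(D in good k) weight Xs Xt #|semiarcs D| #|future D|).

Lemma moment_last n : moment n n = (A 0 0 n)%:R.
Proof.
rewrite /moment subnn expr0 mul1r bicoef_sum.
rewrite (eq_bigr (fun D => (((#|semiarcs D| == 0) && (#|future D| == 0))%N)%:R))
  => [|D _]; last first.
  by rewrite bicoef_weight //; apply/subset_leq_card/future_semi.
rewrite -natr_sum; congr (_%:R); rewrite /A -sum1_card big_mkcond [RHS]big_mkcond.
apply: eq_bigr => D _; rewrite !inE andbA.
by case: (_ && nonnesting 3 D) => //=; case: (_ && _).
Qed.

(** A tree step multiplies the total weight by the factor that the exponent [n - k] gives up, so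
    consecutive moments differ by error terms only. *)
Lemma moment_step n k : (k < n)%N ->
  moment n k.+1 = moment n k
    + \sum_(0 <= i < k.+1) \sum_(0 <= j < i.+1)
        (A i j k)%:R *
        (\sum_(0 <= p < (n - k).+1) \sum_(0 <= q < (n - k).+1)
           \sum_(0 <= r < (n - k).+1 | (p + q + r == n - k)%N)
             multinom (n - k) p%:Z q%:Z r%:Z *
             multinom (n - k - 1) (p%:Z - i%:Z) (q%:Z + i%:Z) (r%:Z - 1) *
             ((r%:R - 1) / (q%:R + i%:R + 1) - 1)).
Proof.
move=> lt_kn; pose C i : rat := bicoef (n - k).+1 (n - k)
  ((1 + Xs + Xt) ^+ (n - k) * (Xs * Xt + Xs + Xt) ^+ (n - k).-1 * (Xs ^+ i.+2 - Xt ^+ i.+2)).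
transitivity (moment n k - \sum_(D in good k) C #|semiarcs D|); last first.
  rewrite (sum_good_states (fun i _ => C i)) -sumrN; congr (_ + _).
  apply: eq_bigr => i _; rewrite -sumrN; apply: eq_bigr => j _.
  by rewrite /C bicoef_correction ?subn_gt0 // -mulNrn opprK mulr_natl.
rewrite /moment subnS /C -(prednK (n := (n - k)%N)) ?subn_gt0 //=.
move: (n - k).-1 => m.
set W := \sum_(E in good k.+1) _; set H := (1 + Xs + Xt) * (Xs * Xt + Xs + Xt).
(* Multiplying by s t shifts both indices by one and makes [weight_recurrence] applicable. *)
have -> : bicoef m.+1 m (H ^+ m * W) = bicoef m.+2 m.+1 (H ^+ m * (Xs * Xt * W)).
  have -> : H ^+ m * (Xs * Xt * W) = H ^+ m * W * (Xs ^+ 1 * Xt ^+ 1) by rewrite !expr1; ring.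
  by rewrite bicoefMST /= !subn1.
rewrite /W weight_recurrence !mulr_sumr !bicoef_sum -sumrB; apply: eq_bigr => D _.
rewrite -bicoefB; congr bicoef; rewrite (exprS H) (exprS (1 + Xs + Xt)) /H exprMn.
move: (weight _ _ _ _) (_ - Xt ^+ _) => w Q.
by ring.
Qed.

Theorem theorem4 (n : nat) :
  #|nonnesting_partitions 3 n| = A 0 0 n /\
  (A 0 0 n)%:R =
    \sum_(0 <= a < n.+1) \sum_(0 <= b < n.+1)
      \sum_(0 <= c < n.+1 | (a + b + c == n)%N)
        multinom n a%:Z b%:Z c%:Z ^+ 2 * (1 - c%:R / (b%:R + 1))
    + \sum_(0 <= k < n) \sum_(0 <= i < k.+1) \sum_(0 <= j < i.+1)
        (A i j k)%:R *
        (\sum_(0 <= p < (n - k).+1) \sum_(0 <= q < (n - k).+1)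
           \sum_(0 <= r < (n - k).+1 | (p + q + r == n - k)%N)
             multinom (n - k) p%:Z q%:Z r%:Z *
             multinom (n - k - 1) (p%:Z - i%:Z) (q%:Z + i%:Z) (r%:Z - 1) *
             ((r%:R - 1) / (q%:R + i%:R + 1) - 1))
    :> rat.
Proof.
split; first exact: card_nonnesting_partitions.
rewrite -moment_last -bicoef_initial.
(* The only diagram of size 0 has state (0, 0) and weight s - t. *)
have -> : bicoef n.+1 n (((1 + Xs + Xt) * (Xs * Xt + Xs + Xt)) ^+ n * (Xs - Xt)) = moment n 0.
  by rewrite /moment subn0 (sum_good0 (weight Xs Xt)) /weight expr0 mul1r !expr1.
apply/eqP; rewrite addrC -subr_eq; apply/eqP; rewrite -(telescope_sumr _ (leq0n n)).
by apply: eq_big_nat => k /andP[_ lt_kn]; rewrite moment_step // addrC addKr.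
Qed.
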